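(* Let $\varphi,\varphi_1,\varphi_2\in H^1[0,1]$ and $f\in H_0^1[0,1]$ satisfy $\varphi(0)=0$, $\varphi(1)=1$, $\varphi_1(1)=1$, $\varphi_2(0)=0$, and $0\le\varphi(x)\le 1$, $0\le\varphi_1(x)\le 1$, $0\le\varphi_2(x)\le 1$ for all $x\in[0,1]$. Suppose that $(1+\|\varphi\|)(\|\varphi_1\|+\|\varphi_2\|)<1$. Then there exists exactly one $u\in H_0^1[0,1]$ such that $$u(x)=\varphi(x)\,u(\varphi_1(x))+(1-\varphi(x))\,u(\varphi_2(x))+f(x)\quad\text{for all }x\in[0,1],\qquad u(0)=u(1)=0,$$ and this solution satisfies $$\|u\|\le\frac{\|f\|}{1-(1+\|\varphi\|)(\|\varphi_1\|+\|\varphi_2\|)}.$$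
   Context: $H^1[0,1]$ denotes the space of Lipschitz functions: all $v\in C[0,1]$ (real-valued continuous functions on $[0,1]$) with $\|v\|:=\sup_{x,y\in[0,1],\,x\ne y}\frac{|v(x)-v(y)|}{|x-y|}<\infty$. (This is not a Sobolev space.) For any $v\in H^1[0,1]$ the symbol $\|v\|$ denotes this Lipschitz constant (a seminorm on $H^1[0,1]$). $H_0^1[0,1]$ is the subspace of $v\in H^1[0,1]$ with $v(0)=v(1)=0$; it is a Banach space with norm $\|\cdot\|$. *)

(* Defs.v *)
From HB Require Import structures.
From mathcomp Require Import all_boot all_order all_algebra.
From mathcomp Require Import all_classical all_reals all_analysis.
Set Implicit Arguments.
Unset Strict Implicit.
Unset Printing Implicit Defensive.
Import Order.TTheory GRing.Theory Num.Theory.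
Import numFieldNormedType.Exports.
Local Open Scope classical_set_scope.
Local Open Scope ring_scope.

(* Real functions on [0, 1] are represented by total functions [R -> R]; two of
   them denote the same element of a function space iff they agree on [0, 1].
   The definitions below depend only on the values on [0, 1], for [solves]
   provided that phi1 and phi2 map [0, 1] into itself. *)

Definition slopes01 (R : realType) (v : R -> R) : set R :=
  [set q | exists x y : R,
    [/\ x \in `[0, 1], y \in `[0, 1], x != y
      & q = `|v x - v y| / `|x - y| ]].

(* [sup] is total on [set R]; it is the genuine supremum when [H1space v] holds,
   since [slopes01 v] is never empty. *)
Definition lip01 (R : realType) (v : R -> R) : R := sup (slopes01 v).

Definition H1space (R : realType) (v : R -> R) : Prop :=
  {within `[0, 1], continuous v} /\ has_ubound (slopes01 v).

Definition H10space (R : realType) (v : R -> R) : Prop :=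
  [/\ H1space v, v 0 = 0 & v 1 = 0].

Definition solves (R : realType) (phi phi1 phi2 f u : R -> R) : Prop :=
  [/\ forall x : R, x \in `[0, 1] ->
        u x = phi x * u (phi1 x) + (1 - phi x) * u (phi2 x) + f x,
      u 0 = 0 & u 1 = 0].

(* Main.v *)
(* The averaging operator T u = phi (u \o phi1) + (1 - phi) (u \o phi2) is controlled
   through the identity
     T u x - T u y = phi x (u (phi1 x) - u (phi1 y))
                     + (1 - phi x) (u (phi2 x) - u (phi2 y))
                     + (phi x - phi y) (u (phi1 y) - u (phi2 y)).
   Since u vanishes at phi1 1 = 1 and phi2 0 = 0, the last factor is at most
   ||u|| (||phi1|| + ||phi2||), so T is linear on H_0^1 with norm at most
   K = (1 + ||phi||) (||phi1|| + ||phi2||) < 1. The Picard iterates of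
   u |-> T u + f then converge pointwise, and all of them have Lipschitz constant
   at most ||f|| / (1 - K), which passes to the limit. *)
Require Import Defs.
From mathcomp Require Import all_boot all_order all_algebra.
From mathcomp Require Import all_classical all_reals all_analysis.
From mathcomp Require Import ring lra.
Set Implicit Arguments.
Unset Strict Implicit.
Unset Printing Implicit Defensive.
Import Order.TTheory GRing.Theory Num.Theory.
Import numFieldNormedType.Exports.
Local Open Scope classical_set_scope.
Local Open Scope ring_scope.

(** * Lipschitz bounds on [0, 1] and convergence tools *)

Lemma mem_itv01 (R : realType) (x : R) : (x \in `[0, 1]) = (0 <= x <= 1).
Proof. by rewrite in_itv. Qed.

(** Allows any admissible constant, so estimates can be chained before the supremum [lip01] is known
    to be finite. *)
Definition lipschitz01 (R : realType) (C : R) (v : R -> R) : Prop :=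
  forall x y : R, 0 <= x <= 1 -> 0 <= y <= 1 -> `|v x - v y| <= C * `|x - y|.

Section Lipschitz.
Context {R : realType}.
Implicit Types (v : R -> R) (C : R).

Lemma lipschitz01_slopes v C :
  lipschitz01 C v <-> ubound (slopes01 v) C.
Proof.
split=> [hv _ [x [y [x01 y01 xy ->]]]|hv x y x01 y01].
  rewrite ler_pdivrMr ?normr_gt0 ?subr_eq0//.
  by apply: hv; rewrite -mem_itv01.
have [->|xy] := eqVneq x y; first by rewrite !subrr normr0 mulr0.
rewrite -ler_pdivrMr ?normr_gt0 ?subr_eq0//; apply: hv.
by exists x, y; rewrite !mem_itv01.
Qed.

Lemma slopes01_neq0 v : slopes01 v !=set0.
Proof.
exists (`|v 0 - v 1| / `|0 - 1|); exists 0, 1.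
by split=> //; rewrite ?mem_itv01 ?lexx ?ler01// eq_sym oner_eq0.
Qed.

Lemma lip01_le v C : lipschitz01 C v -> lip01 v <= C.
Proof.
by move=> /lipschitz01_slopes hv; apply: ge_sup => //; exact: slopes01_neq0.
Qed.

Lemma H1space_lipschitz v : H1space v -> lipschitz01 (lip01 v) v.
Proof. by case=> _ hv; apply/lipschitz01_slopes/ub_le_sup. Qed.

Lemma lipschitz01_ge0 v C : lipschitz01 C v -> 0 <= C.
Proof.
move=> /(_ 0 1); rewrite !lexx !ler01 => /(_ isT isT).
by rewrite sub0r normrN1 mulr1; exact: le_trans.
Qed.

Lemma lip01_ge0 v : H1space v -> 0 <= lip01 v.
Proof. by move/H1space_lipschitz/lipschitz01_ge0. Qed.

Lemma lipschitz01_H1space v C : lipschitz01 C v -> H1space v.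
Proof.
move=> hv; split; last by exists C; apply/lipschitz01_slopes.
have C0 := lipschitz01_ge0 hv.
apply/subspace_continuousP => x /=; rewrite in_itv/= => x01.
apply/cvgrPdist_lt => e e0.
near=> y.
have y01 : 0 <= y <= 1.
  suff: y \in `[0, 1] by rewrite in_itv.
  by near: y; exact: withinT.
apply: le_lt_trans (hv x y x01 y01) _.
(* [C + 1] rather than [C], since [C] may be zero. *)
suff: `|x - y| < e / (C + 1).
  rewrite ltr_pdivlMr ?ltr_wpDl//; have := normr_ge0 (x - y); nra.
near: y; apply: cvg_within.
by apply: nbhsx_ballx; rewrite divr_gt0// ltr_wpDl.
Unshelve. all: by end_near. Qed.

Lemma lipschitz01B v w A B : lipschitz01 A v -> lipschitz01 B w ->
  lipschitz01 (A + B) (v \- w).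
Proof.
move=> hv hw x y x01 y01 /=; have := hv x y x01 y01; have := hw x y x01 y01.
have := ler_normB (v x - v y) (w x - w y).
have -> : v x - w x - (v y - w y) = v x - v y - (w x - w y) by ring.
lra.
Qed.

Lemma lipschitz01_cvg (u_ : nat -> R -> R) v C :
  (forall n, lipschitz01 C (u_ n)) ->
  (forall x, 0 <= x <= 1 -> u_ ^~ x @ \oo --> v x) -> lipschitz01 C v.
Proof.
move=> hu uv x y x01 y01.
have hd : (fun n => `|u_ n x - u_ n y|) @ \oo --> `|v x - v y|.
  by apply: cvg_norm; apply: cvgB; exact: uv.
apply: (cvgr_to_le hd).
by near=> n; exact: hu.
Unshelve. all: by end_near. Qed.

(** A geometric series dominates the increments, so the telescoping series converges absolutely; [a]
    is its partial sums shifted by [a 0]. *)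
Lemma cvg_contracting_increments (a : R ^nat) K M : 0 <= K < 1 ->
  (forall n, `|a n.+1 - a n| <= M * K ^+ n) -> cvgn a.
Proof.
move=> /andP[K0 K1] ha.
have M0 : 0 <= M by have := le_trans (normr_ge0 _) (ha 0%N); rewrite expr0 mulr1.
have /normed_cvg cd : cvgn [normed series (telescope a)].
  apply: (@series_le_cvg _ _ (geometric M K)) => //= n.
  - by rewrite mulr_ge0// exprn_ge0.
  - by apply: is_cvg_geometric_series; rewrite ger0_norm.
have -> : a = (fun n => a 0%N + series (telescope a) n).
  by apply/funext => n; rewrite telescopeK addrC subrK.
by apply: is_cvgD => //; exact: is_cvg_cst.
Qed.

End Lipschitz.

(** * The averaging operator *)

Section Averaging.
Context {R : realType}.
Variables (phi phi1 phi2 : R -> R) (L L1 L2 : R).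
Hypothesis phiL : lipschitz01 L phi.
Hypothesis phi1L : lipschitz01 L1 phi1.
Hypothesis phi2L : lipschitz01 L2 phi2.
Hypotheses (phi_0 : phi 0 = 0) (phi_1 : phi 1 = 1).
Hypotheses (phi1_1 : phi1 1 = 1) (phi2_0 : phi2 0 = 0).
Hypothesis phi_01 : forall x : R, 0 <= x <= 1 -> 0 <= phi x <= 1.
Hypothesis phi1_01 : forall x : R, 0 <= x <= 1 -> 0 <= phi1 x <= 1.
Hypothesis phi2_01 : forall x : R, 0 <= x <= 1 -> 0 <= phi2 x <= 1.

Let K := (1 + L) * (L1 + L2).

Definition averaging (u : R -> R) (x : R) : R :=
  phi x * u (phi1 x) + (1 - phi x) * u (phi2 x).

(** With [averaging1], this keeps the zero boundary values along the iteration. *)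
Lemma averaging0 u : averaging u 0 = u 0.
Proof. by rewrite /averaging phi_0 phi2_0 mul0r add0r subr0 mul1r. Qed.

Lemma averaging1 u : averaging u 1 = u 1.
Proof. by rewrite /averaging phi_1 phi1_1 subrr mul0r addr0 mul1r. Qed.

Lemma averagingB u w : averaging (u \- w) = averaging u \- averaging w.
Proof. by apply/funext => x; rewrite /averaging /=; ring. Qed.

Lemma averaging_factor_ge0 : 0 <= K.
Proof.
rewrite /K; have := lipschitz01_ge0 phiL; have := lipschitz01_ge0 phi1L.
have := lipschitz01_ge0 phi2L; nra.
Qed.

Lemma averaging_lipschitz u C : u 0 = 0 -> u 1 = 0 ->
  lipschitz01 C u -> lipschitz01 (K * C) (averaging u).
Proof.
move=> u0 u1 uC x y x01 y01.
have C0 := lipschitz01_ge0 uC.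
have L_0 := lipschitz01_ge0 phiL.
have L1_0 := lipschitz01_ge0 phi1L.
have L2_0 := lipschitz01_ge0 phi2L.
have I0 : 0 <= (0 : R) <= 1 by rewrite lexx ler01.
have I1 : 0 <= (1 : R) <= 1 by rewrite lexx ler01.
have comp g G z t : lipschitz01 G g -> (forall s, 0 <= s <= 1 -> 0 <= g s <= 1) ->
    0 <= z <= 1 -> 0 <= t <= 1 -> `|u (g z) - u (g t)| <= C * G * `|z - t|.
  move=> gG g01 z01 t01; apply: le_trans (uC _ _ (g01 _ z01) (g01 _ t01)) _.
  by rewrite -mulrA ler_wpM2l// gG.
have b1 := comp _ _ _ _ phi1L phi1_01 x01 y01.
have b2 := comp _ _ _ _ phi2L phi2_01 x01 y01.
(* Compare [phi1 y] with [phi1 1 = 1] and [phi2 y] with [phi2 0 = 0], zeros of [u]; the distances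
   from [y] to 1 and to 0 are at most 1. *)
have gap : `|u (phi1 y) - u (phi2 y)| <= C * (L1 + L2).
  have := comp _ _ _ _ phi1L phi1_01 y01 I1.
  have := comp _ _ _ _ phi2L phi2_01 y01 I0.
  rewrite phi1_1 phi2_0 u0 u1 !subr0 (distrC y) => h2 h1.
  apply: le_trans (ler_normB _ _) _; rewrite mulrDr; apply: lerD.
    apply: le_trans h1 _; rewrite ger0_norm; last lra.
    by rewrite ler_piMr ?mulr_ge0//; lra.
  apply: le_trans h2 _; rewrite ger0_norm; last lra.
  by rewrite ler_piMr ?mulr_ge0//; lra.
have -> : averaging u x - averaging u y =
    phi x * (u (phi1 x) - u (phi1 y)) + (1 - phi x) * (u (phi2 x) - u (phi2 y))
    + (phi x - phi y) * (u (phi1 y) - u (phi2 y)).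
  by rewrite /averaging; ring.
have /andP[px0 px1] := phi_01 x01.
apply: (@le_trans _ _ (phi x * (C * L1 * `|x - y|)
    + (1 - phi x) * (C * L2 * `|x - y|) + L * `|x - y| * (C * (L1 + L2)))).
  apply: le_trans (ler_normD _ _) (lerD _ _).
    apply: le_trans (ler_normD _ _) (lerD _ _); rewrite normrM ger0_norm ?subr_ge0//.
      exact: ler_wpM2l.
    by apply: ler_wpM2l; rewrite ?subr_ge0.
  by rewrite normrM ler_pM// phiL.
(* The slack comes from bounding the convex combination of [L1] and [L2] with weights [phi x] and
   [1 - phi x] by [L1 + L2]. *)
rewrite -subr_ge0 /K.
have -> : (1 + L) * (L1 + L2) * C * `|x - y| - (phi x * (C * L1 * `|x - y|)
    + (1 - phi x) * (C * L2 * `|x - y|) + L * `|x - y| * (C * (L1 + L2))) =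
    C * `|x - y| * ((1 - phi x) * L1 + phi x * L2) by ring.
by rewrite mulr_ge0 ?mulr_ge0// addr_ge0 ?mulr_ge0// subr_ge0.
Qed.

(** * Picard iteration from zero, and uniqueness *)

Variables (f : R -> R) (F : R).
Hypotheses (f0 : f 0 = 0) (f1 : f 1 = 0).
Hypothesis fF : lipschitz01 F f.
Hypothesis K1 : K < 1.

Let picard n := iter n (fun u => averaging u \+ f) (fun=> 0).

Let picard0 n : picard n 0 = 0.
Proof. by elim: n => //= n IH; rewrite averaging0 IH f0 addr0. Qed.

Let picard1 n : picard n 1 = 0.
Proof. by elim: n => //= n IH; rewrite averaging1 IH f1 addr0. Qed.

(** [F / (1 - K)] is the fixed point of [C |-> K * C + F], so the bound reproduces itself at each
    step. *)
Let picard_lipschitz n : lipschitz01 (F / (1 - K)) (picard n).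
Proof.
have F0 := lipschitz01_ge0 fF.
have K1' : 0 < 1 - K by rewrite subr_gt0.
elim: n => [|n IH] x y x01 y01.
  by rewrite subrr normr0 mulr_ge0// divr_ge0// ltW.
have FE : F / (1 - K) = K * (F / (1 - K)) + F by field; rewrite gt_eqF.
rewrite [picard _]/= -/(picard n) opprD addrACA.
apply: le_trans (ler_normD _ _) _; rewrite {1}FE mulrDl lerD ?fF//.
by apply: averaging_lipschitz.
Qed.

(** The first increment is [f]; afterwards [f] cancels and, by linearity, each increment is the
    operator applied to the previous one, gaining a factor [K]. *)
Let picard_increment n : lipschitz01 (F * K ^+ n) (picard n.+1 \- picard n).
Proof.
elim: n => [|n IH].
  move=> x y x01 y01.
  by rewrite /= /averaging !mulr0 !addr0 !add0r !subr0 mulr1; exact: fF.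
have -> : picard n.+2 \- picard n.+1 = averaging (picard n.+1 \- picard n).
  rewrite averagingB; apply/funext => x.
  rewrite -[LHS]/(averaging (picard n.+1) x + f x
                  - (averaging (picard n) x + f x)) /=.
  by rewrite opprD addrACA subrr addr0.
rewrite exprS mulrCA; apply: averaging_lipschitz => //.
  by rewrite -[LHS]/(picard n.+1 0 - picard n 0) !picard0 subrr.
by rewrite -[LHS]/(picard n.+1 1 - picard n 1) !picard1 subrr.
Qed.

Lemma averaging_fixpoint : exists u : R -> R,
  [/\ u 0 = 0, u 1 = 0, lipschitz01 (F / (1 - K)) u
    & forall x, 0 <= x <= 1 -> u x = averaging u x + f x].
Proof.
pose u x := limn (picard ^~ x).
have cu x : 0 <= x <= 1 -> picard ^~ x @ \oo --> u x.
  move=> x01; apply: (@cvg_contracting_increments _ _ K F).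
    by rewrite averaging_factor_ge0.
  (* Comparing with the point 0, where the iterates vanish, turns the Lipschitz bound into a
     pointwise one. *)
  move=> n; have := @picard_increment n x 0 x01; rewrite lexx ler01 => /(_ isT).
  rewrite -[(_ \- _) 0]/(picard n.+1 0 - picard n 0) !picard0 !subr0.
  move=> /le_trans; apply; rewrite ler_piMr//; last by rewrite ger0_norm; lra.
  by rewrite mulr_ge0 ?(lipschitz01_ge0 fF)// exprn_ge0// averaging_factor_ge0.
exists u; split.
- by rewrite /u (_ : picard ^~ 0 = cst 0) ?lim_cst//; apply/funext.
- by rewrite /u (_ : picard ^~ 1 = cst 0) ?lim_cst//; apply/funext.
- exact: lipschitz01_cvg picard_lipschitz cu.
(* Pass to the limit in the recursion: the shifted sequence has the same limit, and [phi1 x],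
   [phi2 x] stay in [0, 1], where convergence is known. *)
- move=> x x01; apply: (@cvg_unique _ (@norm_hausdorff _ _) _ _ _ _ (cu x x01)).
  rewrite /= -cvg_shiftS; apply: cvgD; last exact: cvg_cst.
  by apply: cvgD; apply: cvgMr; apply: cu; auto.
Qed.

(** Contraction applied to the least constant gives [lip01 w <= K * lip01 w], hence [lip01 w = 0];
    so [w] is constant on [0, 1], equal to [w 0]. *)
Lemma averaging_fixpoint0 w C : lipschitz01 C w -> w 0 = 0 -> w 1 = 0 ->
  (forall x, 0 <= x <= 1 -> w x = averaging w x) ->
  forall x, 0 <= x <= 1 -> w x = 0.
Proof.
move=> wC w0 w1 ww x x01.
have H1w := lipschitz01_H1space wC.
have wL := H1space_lipschitz H1w.
have : lip01 w <= K * lip01 w.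
  apply: lip01_le => y z y01 z01; rewrite (ww y)// (ww z)//.
  exact: averaging_lipschitz.
move=> lwK; have lw0 : lip01 w = 0.
  apply/eqP; rewrite eq_le lip01_ge0// andbT.
  by rewrite -(@pmulr_rle0 _ (1 - K)) ?subr_gt0// mulrBl mul1r subr_le0.
have := wL x 0 x01; rewrite lexx ler01 => /(_ isT).
by rewrite lw0 mul0r w0 subr0 normr_le0 => /eqP.
Qed.

End Averaging.

Theorem theorem1 (R : realType) (phi phi1 phi2 f : R -> R)
  (Hphi : H1space phi) (Hphi1 : H1space phi1) (Hphi2 : H1space phi2) (Hf : H10space f)
  (phi_0 : phi 0 = 0) (phi_1 : phi 1 = 1)
  (phi1_1 : phi1 1 = 1) (phi2_0 : phi2 0 = 0)
  (phi_01 : forall x : R, x \in `[0, 1] -> 0 <= phi x <= 1)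
  (phi1_01 : forall x : R, x \in `[0, 1] -> 0 <= phi1 x <= 1)
  (phi2_01 : forall x : R, x \in `[0, 1] -> 0 <= phi2 x <= 1)
  (Hlt1 : (1 + lip01 phi) * (lip01 phi1 + lip01 phi2) < 1) :
  exists u : R -> R,
    [/\ H10space u,
        solves phi phi1 phi2 f u,
        forall v : R -> R, H10space v -> solves phi phi1 phi2 f v ->
          forall x : R, x \in `[0, 1] -> v x = u x
      & lip01 u <=
          lip01 f / (1 - (1 + lip01 phi) * (lip01 phi1 + lip01 phi2))].
Proof.
have in01 (P : R -> Prop) : (forall x : R, x \in `[0, 1] -> P x) ->
    forall x : R, 0 <= x <= 1 -> P x.
  by move=> hP x x01; apply: hP; rewrite mem_itv01.
have [Hf1 f0 f1] := Hf.
have phiL := H1space_lipschitz Hphi.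
have phi1L := H1space_lipschitz Hphi1.
have phi2L := H1space_lipschitz Hphi2.
have fL := H1space_lipschitz Hf1.
have [u [u0 u1 uL uE]] := averaging_fixpoint phiL phi1L phi2L phi_0 phi_1 phi1_1
  phi2_0 (in01 _ phi_01) (in01 _ phi1_01) (in01 _ phi2_01) f0 f1 fL Hlt1.
have Hu := lipschitz01_H1space uL.
exists u; split.
- by [].
- by split=> // x; rewrite mem_itv01; exact: uE.
- move=> v [Hv v0 v1] [vE _ _] x; rewrite mem_itv01 => x01.
  (* In the difference of two solutions [f] cancels, leaving the homogeneous equation. *)
  suff /(_ x x01)/eqP : forall y, 0 <= y <= 1 -> (v \- u) y = 0.
    by rewrite /= subr_eq0 => /eqP.
  apply: (averaging_fixpoint0 phiL phi1L phi2L phi1_1 phi2_0 (in01 _ phi_01)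
    (in01 _ phi1_01) (in01 _ phi2_01) Hlt1
    (lipschitz01B (H1space_lipschitz Hv) (H1space_lipschitz Hu))).
  + by rewrite /= v0 u0 subrr.
  + by rewrite /= v1 u1 subrr.
  + move=> y y01; rewrite averagingB /= (in01 _ vE y y01) (uE y y01) /averaging.
    by ring.
- exact: lip01_le.
Qed.
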